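(* For each integer $n\ge1$, let $\mathbf{M}_n$ be a uniformly random matching on $[2n]$, let $L=\sum_{e\in\mathbf{M}_n}\ell(e)$ be the sum of the lengths of its edges, and let $\bar L=\frac Ln$. Then for every $n\ge1$, $$\mathbb{E}\,\bar L=\frac{2n+1}{3}.$$ Moreover, for every function $\omega$ with $\omega(n)\to\infty$ as $n\to\infty$, $$\lim_{n\to\infty}\mathbb{P}\left(\left|\bar L-\frac{2n}3\right|\le\omega(n)\sqrt n\right)=1.$$
   Context: $[m]=\{1,2,\dots,m\}$. A matching on $[2n]$ is a partition of $[2n]$ into $n$ two-element subsets, called edges; a uniformly random matching is chosen uniformly from all $\frac{(2n)!}{2^n n!}$ of them. The length of an edge $e=\{i,j\}$ with $1\le i<j\le 2n$ is $\ell(e)=j-i$. *)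

(* Defs.v *)
From mathcomp Require Import all_boot all_order all_algebra.
From mathcomp Require Import reals.
Import Order.TTheory GRing.Theory Num.Theory.

Set Implicit Arguments.
Unset Strict Implicit.
Unset Printing Implicit Defensive.

Local Open Scope ring_scope.

(* The ground set {1, ..., 2n} is encoded as 'I_(2 * n) = {0, ..., 2n - 1};
   edge lengths are invariant under this shift. *)
Definition is_matching (n : nat) (M : {set {set 'I_(2 * n)}}) : bool :=
  partition M [set: 'I_(2 * n)] && [forall e in M, #|e| == 2%N].

Definition matchings (n : nat) : {set {set {set 'I_(2 * n)}}} :=
  [set M | is_matching M].

(* For e = {i, j} with i < j, the sum has the single term j - i
   (see edge_length_set2). *)
Definition edge_length (m : nat) (e : {set 'I_m}) : nat :=
  (\sum_(i in e) \sum_(j in e | i < j) (j - i))%N.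

Definition total_length (n : nat) (M : {set {set 'I_(2 * n)}}) : nat :=
  (\sum_(e in M) edge_length e)%N.

Definition avg_length (R : realType) (n : nat) (M : {set {set 'I_(2 * n)}}) : R :=
  (total_length M)%:R / n%:R.

(* Expectation and probability for an element drawn uniformly from a finite
   set A. *)
Definition unif_expectation (R : realType) (T : finType) (A : {set T})
    (X : T -> R) : R :=
  (\sum_(x in A) X x) / #|A|%:R.

Definition unif_prob (R : realType) (T : finType) (A : {set T})
    (E : pred T) : R :=
  #|[set x in A | E x]|%:R / #|A|%:R.

Lemma edge_length_set2 (m : nat) (i j : 'I_m) :
  (i < j)%N -> edge_length [set i; j] = (j - i)%N.
Proof.
move=> ij; have nij : i != j by rewrite neq_ltn ij.
rewrite /edge_length big_setU1 ?inE//= big_set1 !big_mkcondr/=.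
rewrite !big_setU1 ?inE//= !big_set1 !ltnn ij ltnNge (ltnW ij)/=.
by rewrite !addn0 add0n.
Qed.

(* Main.v *)
(** The symmetric group acts on matchings, so every edge lies in the same
    number of them and double counting gives P(e in M) = 1/(2n-1) and
    P(e, f in M) = 1/((2n-1)(2n-3)) for disjoint e, f. The first identity
    yields the expectation. Distinct edges that meet never occur together, so
    the covariances contribute at most E[L]^2 * 2/(2n-3) = O(n^3) to Var L and
    the diagonal at most n (2n)^2; hence the mean square deviation of L/n from
    2n/3 is at most 9n, and Chebyshev's inequality concludes. *)
Require Import Defs.
From mathcomp Require Import all_boot all_order all_algebra fingroup perm.
From mathcomp Require Import all_classical all_reals all_analysis.
From mathcomp Require Import zify ring lra.
Import Order.TTheory GRing.Theory Num.Theory.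
Import numFieldNormedType.Exports.

Set Implicit Arguments.
Unset Strict Implicit.
Unset Printing Implicit Defensive.

(** * Permutations of the ground set and their action on matchings *)

(** Swapping some [a] in [A :\: B] with some [b] in [B :\: A] shrinks [A :\: B], so induction on its
    size composes transpositions. The bound on the support is what later keeps the other edges
    fixed. *)
Lemma perm_on_imset (T : finType) (A B : {set T}) :
  #|A| = #|B| -> exists2 s : {perm T}, perm_on (A :|: B) s & s @: A = B.
Proof.
have [k] := ubnP #|A :\: B|; elim: k => // k IHk in A *; rewrite ltnS => leAk.
move=> eqAB; have [sAB|/subsetPn[a aA aNB]] := boolP (A \subset B).
  exists 1%g; first exact: perm_on1.
  by rewrite imset_perm1; apply/eqP; rewrite eqEcard sAB eqAB /=.
have [b bB bNA] : exists2 b, b \in B & b \notin A.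
  apply/subsetPn; apply: contraNN aNB => sBA.
  by have /eqP -> : B == A by rewrite eqEcard sBA eqAB /=.
pose A' : {set T} := tperm a b @: A.
have A'E : A' = b |: (A :\ a).
  apply/setP => x; rewrite !inE; apply/imsetP/idP => [[y yA ->]|].
    case: tpermP => [_|yb|/eqP ya _]; first by rewrite eqxx.
      by rewrite -yb yA in bNA.
    by rewrite ya yA orbT.
  case/orP => [/eqP ->|/andP[xa xA]]; first by exists a; rewrite ?tpermL.
  exists x => //; rewrite tpermD // eq_sym //.
  by apply: contraNneq bNA => <-.
have [||s sP sA'] := IHk A'.
- apply: leq_trans leAk; apply: proper_card; apply/properP; split.
    apply/fintype.subsetP => x; rewrite A'E !inE => /andP[xB].
    by case/orP => [/eqP xb|/andP[_ ->]]; [rewrite xb bB in xB | rewrite xB].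
  exists a; rewrite ?inE ?aA ?aNB // A'E !inE eqxx /= orbF.
  by apply: contraNneq bNA => <-.
- by rewrite card_imset //; apply: perm_inj.
exists (tperm a b * s)%g.
  apply: perm_onM.
    apply/fintype.subsetP => x; rewrite !inE; case: tpermP => [->|->|]; rewrite ?eqxx //.
      by rewrite aA.
    by rewrite bB orbT.
  apply: fintype.subset_trans sP _; rewrite A'E; apply/fintype.subsetP => x; rewrite !inE.
  by case/orP => [/orP[/eqP->|/andP[_ ->]]|->]; rewrite ?bB ?orbT.
rewrite -sA' /A' -imset_comp; apply: eq_imset => x /=; exact: permM.
Qed.

Lemma matching_imset (n : nat) (s : {perm 'I_(2 * n)})
    (M : {set {set 'I_(2 * n)}}) :
  M \in matchings n -> [set s @: e | e : {set 'I_(2 * n)} in M] \in matchings n.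
Proof.
rewrite !inE => /andP[pM /forallP cM]; apply/andP; split.
  have -> : [set: 'I_(2 * n)] = s @: [set: 'I_(2 * n)].
    by apply/eqP; rewrite eq_sym eqEcard finset.subsetT /= card_imset //; apply: perm_inj.
  by rewrite imset_partition //; apply: perm_inj.
apply/forallP => e; apply/implyP => /imsetP[f fM ->].
by rewrite card_imset ?(implyP (cM f)) //; apply: perm_inj.
Qed.

(** The witness pairs each point with its mirror image; [rev_ord] has no fixed point because the
    ground set has even size. *)
Lemma matchings_neq0 (n : nat) : matchings n != finset.set0.
Proof.
have revN (i : 'I_(2 * n)) : rev_ord i != i.
  by apply/eqP => /(congr1 val) /=; have := ltn_ord i; lia.
pose pairOf (i : 'I_(2 * n)) : {set 'I_(2 * n)} := [set i; rev_ord i].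
apply/set0Pn; exists (preim_partition pairOf [set: 'I_(2 * n)]).
rewrite inE; apply/andP; split; first exact: preim_partitionP.
apply/forallP => e; apply/implyP => /imsetP[i _ ->].
suff -> : [set y in [set: 'I_(2 * n)] | pairOf i == pairOf y] = pairOf i.
  by rewrite cards2 [i == _]eq_sym revN.
apply/setP => j; rewrite !inE /=; apply/eqP/orP.
  by move=> /setP/(_ j); rewrite !inE eqxx /= => /orP.
by case=> /eqP -> //; rewrite /pairOf rev_ordK finset.setUC.
Qed.

(** * Number of matchings containing prescribed edges *)

Section MatchingCounts.
Variable n : nat.
Implicit Types (e f : {set 'I_(2 * n)}) (M Q : {set {set 'I_(2 * n)}}).

Definition matchings_over Q := [set M in matchings n | Q \subset M].

Lemma card_edge M e : M \in matchings n -> e \in M -> #|e| = 2.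
Proof. by rewrite inE => /andP[_ /forallP/(_ e)/implyP h] /h/eqP. Qed.

Lemma disjoint_edges M e f :
  M \in matchings n -> e \in M -> f \in M -> e != f -> [disjoint e & f].
Proof.
by rewrite inE => /andP[/partition_trivIset/finset.trivIsetP h _]; apply: h.
Qed.

Lemma card_matching M : M \in matchings n -> #|M| = n.
Proof.
move=> Mn; have := Mn; rewrite inE => /andP[pM _].
have := card_uniform_partition (fun e => @card_edge M e Mn) pM.
rewrite cardsT card_ord; lia.
Qed.

Lemma card_cover_edges M Q :
  M \in matchings n -> Q \subset M -> #|finset.cover Q| = (2 * #|Q|)%N.
Proof.
move=> Mn QM; have := Mn; rewrite inE => /andP[/partition_trivIset tM _].
have /eqP <- := finset.trivIsetS QM tM.
rewrite (eq_bigr (fun=> 2)) ?sum_nat_const 1?mulnC // => e eQ.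
exact: card_edge Mn (fintype.subsetP QM _ eQ).
Qed.

(** A permutation maps the matchings over [Q] injectively to those over the image of [Q]; applying
    this to [s^-1] as well gives equality. *)
Lemma card_matchings_over_imset (s : {perm 'I_(2 * n)}) Q :
  #|matchings_over [set s @: e | e : {set 'I_(2 * n)} in Q]| = #|matchings_over Q|.
Proof.
have le (t : {perm 'I_(2 * n)}) Q' :
    #|matchings_over Q'| <=
      #|matchings_over [set t @: e | e : {set 'I_(2 * n)} in Q']|.
  have inj_t : injective (fun M => [set t @: e | e : {set 'I_(2 * n)} in M]).
    by apply: imset_inj; apply: imset_inj; apply: perm_inj.
  rewrite -(card_imset _ inj_t); apply: subset_leq_card.
  apply/fintype.subsetP => _ /imsetP[M /setIdP[Mn QM] ->].
  by apply/setIdP; split; [exact: matching_imset | exact: finset.imsetS].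
apply/eqP; rewrite eqn_leq le andbT.
apply: leq_trans (le s^-1%g _) _; rewrite -imset_comp.
by under eq_imset => e do rewrite /= -imset_comp (eq_imset _ (permK s)) imset_id;
  rewrite imset_id.
Qed.

(* Double counting of the pairs (f, M) with [f |: Q \subset M]: by symmetry
   each of the admissible edges f lies in equally many of these matchings. *)
Lemma card_matchings_overU1 Q e :
  #|e| = 2 -> [disjoint e & finset.cover Q] ->
  (#|matchings_over (e |: Q)| * (2 * (n - #|Q|)).-1 = #|matchings_over Q|)%N.
Proof.
(* If no matching contains [Q], both sides vanish; otherwise some [M0] containing [Q] shows that [Q]
   covers exactly [2 * #|Q|] points. *)
move=> e2 eQ; have [Q0|[M0]] := set_0Vmem (matchings_over Q).
  rewrite Q0 cards0; suff -> : matchings_over (e |: Q) = finset.set0.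
    by rewrite cards0.
  apply/eqP; rewrite -finset.subset0 -Q0; apply/fintype.subsetP => M.
  by rewrite !inE => /andP[-> /(fintype.subset_trans (finset.subsetUr _ _))].
rewrite inE => /andP[M0n QM0].
have cQ := card_cover_edges M0n QM0.
pose F : {set {set 'I_(2 * n)}} := [set f : {set _} | f \subset ~: finset.cover Q & #|f| == 2].
(* A permutation taking [e] to [f] and supported on their union moves no point covered by [Q], hence
   fixes every edge of [Q]. *)
have Nf f : f \in F -> #|matchings_over (f |: Q)| = #|matchings_over (e |: Q)|.
  rewrite inE -finset.disjoints_subset => /andP[fQ /eqP f2].
  have [s sP <-] := perm_on_imset (etrans e2 (esym f2)).
  rewrite -(card_matchings_over_imset s (e |: Q)) imsetU1; congr #|matchings_over (_ |: _)|.
  rewrite -[LHS]imset_id; apply: eq_in_imset => g gQ.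
  rewrite -[LHS]imset_id; apply: eq_in_imset => x xg; rewrite (out_perm sP) //.
  have xQ : x \in finset.cover Q by apply/finset.bigcupP; exists g.
  by rewrite inE negb_or (disjointFl eQ) // (disjointFl fQ).
have cF : #|F| = ((n - #|Q|) * (2 * (n - #|Q|)).-1)%N.
  rewrite cards_draws cardsCs finset.setCK cQ card_ord -mulnBr bin2 -mulnA mul2n.
  by rewrite doubleK.
have Qltn : #|Q| < n.
  have : #|e :|: finset.cover Q| <= #|'I_(2 * n)| by apply: max_card.
  by rewrite cardsU (disjoint_setI0 eQ) cards0 e2 cQ card_ord; lia.
(* The extra factor [n - #|Q|] is the number of edges [f] that each matching over [Q] contributes to
   the double count; it also occurs in [#|F|]. *)
apply/eqP; rewrite -(eqn_pmul2l (_ : 0 < n - #|Q|)) ?subn_gt0 //; apply/eqP.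
transitivity (\sum_(f in F) #|matchings_over (f |: Q)|).
  by rewrite (eq_bigr _ Nf) sum_nat_const cF; lia.
transitivity (\sum_(f in F) \sum_(M in matchings_over Q | f \in M) 1).
  apply: eq_bigr => f fF; rewrite sum1dep_card; apply: eq_card => M.
  by rewrite !inE finset.subUset finset.sub1set -andbA [(f \in M) && _]andbC.
rewrite (exchange_big_dep (mem (matchings_over Q))) /=; last by move=> f M _ /andP[].
rewrite [RHS]mulnC -[RHS]sum_nat_const; apply: eq_bigr => M /setIdP[Mn QM].
(* Edges of [M] are pairwise disjoint, so those avoiding the points covered by [Q] are exactly those
   outside [Q]. *)
transitivity #|M :\: Q|; last by rewrite cardsDS // card_matching.
rewrite sum1dep_card; apply: eq_card => f.
have isM : is_matching M by rewrite inE in Mn.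
rewrite !inE isM QM /=.
have [fM|] := boolP (f \in M); last by rewrite !andbF.
rewrite (card_edge Mn fM) eqxx !andbT -finset.disjoints_subset; apply/idP/idP.
  apply: contraTN => fQ; rewrite -finset.setI_eq0.
  have /eqP -> : f :&: finset.cover Q == f by apply/eqP/finset.setIidPl; apply: finset.bigcup_sup.
  by rewrite -cards_eq0 (card_edge Mn fM).
move=> fNQ; apply: finset.bigcup_disjoint => g gQ.
apply: (disjoint_edges Mn fM (fintype.subsetP QM _ gQ)).
by apply: contraNneq fNQ => ->.
Qed.

End MatchingCounts.

(** * Lengths summed over all possible edges *)

(** Truncated subtraction kills the terms with [j <= i]. In the induction the new row is zero, the
    new column sums to ['C(m.+1, 2)], and Pascal's rule concludes. *)
Lemma sum_subn (m : nat) : (\sum_(i < m) \sum_(j < m) (j - i) = 'C(m.+1, 3))%N.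
Proof.
elim: m => [|m IHm]; first by rewrite big_ord0.
rewrite big_ord_recr /= [X in (_ + X)%N]big1 ?addn0 => [|j _]; last first.
  by apply/eqP; rewrite subn_eq0 -ltnS.
under eq_bigr do rewrite big_ord_recr /=.
rewrite big_split /= IHm [RHS]binS; congr addn.
rewrite (reindex_inj rev_ord_inj) /= -bin2_sum big_mkord big_ord_recl /= add0n.
by apply: eq_bigr => i _; rewrite subKn.
Qed.

Lemma sum_edge_length (m : nat) :
  (\sum_(e : {set 'I_m} | #|e| == 2) edge_length e = 'C(m.+1, 3))%N.
Proof.
rewrite -sum_subn (exchange_big_dep predT) //=; apply: eq_bigr => i _.
rewrite (exchange_big_dep (fun j : 'I_m => i < j)) /=; last by move=> e j _ /andP[].
rewrite big_mkcond; apply: eq_bigr => j _; case: ltnP => [ij|]; last first.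
  by rewrite -subn_eq0 => /eqP.
rewrite (big_pred1 [set i; j]) // => e /=; apply/idP/eqP; last first.
  by move=> ->; rewrite cards2 !inE !eqxx orbT neq_ltn ij.
move=> /andP[/andP[/eqP e2 ie] /andP[je _]]; apply/eqP.
by rewrite eq_sym eqEcard finset.subUset !finset.sub1set ie je cards2 e2 neq_ltn ij.
Qed.

Lemma edge_length_le (m : nat) (e : {set 'I_m}) : #|e| = 2 -> edge_length e <= m.
Proof.
move=> /eqP/cards2P[i [j [ij ->]]]; wlog lt_ij : i j ij / i < j => [wl|].
  have [/wl|/wl|/val_inj ji] := ltngtP i j; first exact.
    by rewrite finset.setUC; apply; rewrite eq_sym.
  by rewrite ji eqxx in ij.
by rewrite edge_length_set2 //; have := ltn_ord j; lia.
Qed.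

(** * First and second moments of the total length, with denominators cleared in [nat] *)

Section Moments.
Variable n : nat.
Implicit Types (e f : {set 'I_(2 * n)}) (M Q : {set {set 'I_(2 * n)}}).

Lemma matchings_over0 : matchings_over finset.set0 = matchings n.
Proof. by apply/setP => M; rewrite !inE finset.sub0set andbT. Qed.

Lemma card_matchings_over1 e :
  #|e| = 2 -> (#|matchings_over [set e]| * (2 * n).-1 = #|matchings n|)%N.
Proof.
move=> e2; rewrite -matchings_over0 -(@card_matchings_overU1 n finset.set0 e) //.
  by rewrite finset.setU0 cards0 subn0.
by rewrite /finset.cover big_set0 -finset.setI_eq0 finset.setI0.
Qed.

(** Disjoint edges give equality, by adding one edge at a time; distinct edges that meet share no
    matching, so the count is then zero. *)
Lemma card_matchings_over2 e f : #|e| = 2 -> #|f| = 2 -> e != f ->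
  (#|matchings_over [set e; f]| * ((2 * n).-1 * (2 * n.-1).-1) <= #|matchings n|)%N.
Proof.
move=> e2 f2 ef; have [ef0|/pred0Pn[x /andP[/= xe xf]]] := boolP [disjoint e & f].
  rewrite -(card_matchings_over1 f2) -(@card_matchings_overU1 n [set f] e) //.
    by rewrite cards1 subn1 -mulnA [X in (_ * X)%N]mulnC.
  by rewrite finset.cover1.
suff -> : matchings_over [set e; f] = finset.set0 by rewrite cards0 mul0n.
apply/setP => M; rewrite inE finset.in_set0; apply/andP => -[Mn].
rewrite finset.subUset !finset.sub1set => /andP[eM fM].
by have /disjointFr/(_ xe) := disjoint_edges Mn eM fM ef; rewrite xf.
Qed.

Lemma total_lengthE M : M \in matchings n ->
  total_length M = (\sum_(e : {set 'I_(2 * n)} | #|e| == 2) edge_length e * (e \in M))%N.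
Proof.
move=> Mn; rewrite /total_length big_mkcond [RHS]big_mkcond; apply: eq_bigr => e _.
case: (boolP (e \in M)) => [eM|_]; last by rewrite muln0 if_same.
by rewrite (card_edge Mn eM) eqxx muln1.
Qed.

Lemma sum_matchings_over Q :
  (\sum_(M in matchings n) (Q \subset M) = #|matchings_over Q|)%N.
Proof.
rewrite -sum1dep_card big_mkcondr /=; apply: eq_bigr => M _.
by case: (Q \subset M).
Qed.

Lemma sum_total_length :
  (\sum_(M in matchings n) total_length M * (2 * n).-1
     = 'C((2 * n).+1, 3) * #|matchings n|)%N.
Proof.
under eq_bigr => M Mn do rewrite (total_lengthE Mn) big_distrl /=.
rewrite exchange_big /= -sum_edge_length big_distrl /=; apply: eq_bigr => e /eqP e2.
rewrite -big_distrl -big_distrr /= -mulnA; congr muln.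
rewrite -(card_matchings_over1 e2) -sum_matchings_over; congr muln.
by apply: eq_bigr => M _; rewrite finset.sub1set.
Qed.

(** The square expands over ordered pairs of edges. Bounding every pair as if it were disjoint
    produces the square of ['C((2 * n).+1, 3)]; the diagonal is corrected separately, using that
    lengths are at most [2 * n]. *)
Lemma sum_total_length_sqr :
  (\sum_(M in matchings n) total_length M ^ 2 * ((2 * n).-1 * (2 * n.-1).-1)
     <= #|matchings n| *
        ('C((2 * n).+1, 3) ^ 2 + 'C(2 * n, 2) * (2 * n) ^ 2 * (2 * n.-1).-1))%N.
Proof.
set q := (2 * n.-1).-1.
(* The term [(e == f) * q] makes one bound serve both cases: on the diagonal the exact factor is
   [q], and [q <= 1 + q]. *)
have N2 e f : #|e| == 2 -> #|f| == 2 ->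
    (#|matchings_over [set e; f]| * ((2 * n).-1 * q)
       <= #|matchings n| * (1 + (e == f) * q))%N.
  move=> /eqP e2 /eqP f2; have [<-|ef] := eqVneq e f.
    rewrite finset.setUid mulnA card_matchings_over1 // leq_mul2l mul1n leq_addl.
    by rewrite orbT.
  by rewrite mul0n addn0 muln1 card_matchings_over2.
have sumE : (\sum_(M in matchings n) total_length M ^ 2 =
    \sum_(e : {set 'I_(2 * n)} | #|e| == 2) \sum_(f : {set 'I_(2 * n)} | #|f| == 2)
      edge_length e * edge_length f * #|matchings_over [set e; f]|)%N.
  under eq_bigr => M Mn do rewrite (total_lengthE Mn) expnS expn1 big_distrl /=.
  rewrite exchange_big /=; apply: eq_bigr => e _.
  under eq_bigr => M Mn do rewrite big_distrr /=.
  rewrite exchange_big /=; apply: eq_bigr => f _.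
  rewrite -sum_matchings_over big_distrr; apply: eq_bigr => M _ /=.
  rewrite finset.subUset !finset.sub1set mulnACA; congr muln.
  by case: (e \in M); case: (f \in M).
rewrite -big_distrl /= sumE big_distrl /=.
apply: (@leq_trans (\sum_(e : {set 'I_(2 * n)} | #|e| == 2)
    \sum_(f : {set 'I_(2 * n)} | #|f| == 2)
      #|matchings n| * (edge_length e * edge_length f
        + edge_length e * edge_length f * (e == f) * q))).
  apply: leq_sum => e e2; rewrite big_distrl; apply: leq_sum => f f2 /=.
  rewrite -mulnA; apply: leq_trans (leq_mul (leqnn _) (N2 _ _ e2 f2)) _.
  by apply: eq_leq; ring.
under eq_bigr => e _ do rewrite -big_distrr big_split /=.
rewrite -big_distrr big_split /=; apply: leq_mul => //; apply: leq_add.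
  rewrite expnS expn1 -sum_edge_length big_distrl /=.
  by apply: leq_sum => e _; rewrite big_distrr.
have -> : 'C(2 * n, 2) = \sum_(e : {set 'I_(2 * n)} | #|e| == 2) 1.
  by rewrite sum1dep_card card_draws card_ord.
rewrite !big_distrl /=.
apply: leq_sum => e e2; rewrite (bigD1 e) //= big1 ?addn0 => [|f /andP[_ fe]].
  rewrite eqxx muln1 mul1n leq_mul2r; apply/orP; right.
  by rewrite expnS expn1 leq_mul // edge_length_le //; apply/eqP.
by rewrite eq_sym (negPf fe) muln0.
Qed.

End Moments.

(** * The moments over the reals and the mean square deviation *)

Local Open Scope classical_set_scope.
Local Open Scope ring_scope.

Lemma card_matchings_gt0 (R : realType) (n : nat) : 0 < #|matchings n|%:R :> R.
Proof. by rewrite ltr0n card_gt0 matchings_neq0. Qed.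

Lemma natr_bin3 (R : realType) (n : nat) : (1 <= n)%N ->
  'C((2 * n).+1, 3)%:R = n%:R * (2 * n%:R + 1) * ((2 * n).-1)%:R / 3 :> R.
Proof.
move=> n1; have : ('C((2 * n).+1, 3) * 6 = (2 * n).+1 * (2 * n) * (2 * n).-1)%N.
  by rewrite -[6%N]/(3`!)%N bin_ffact !ffactnS ffactn0 muln1 mulnA.
move=> /(congr1 (GRing.natmul (1 : R))); rewrite !natrM -[(2 * n).+1%:R]natr1 natrM => h.
apply: (@mulIf _ 6); first by rewrite pnatr_eq0.
by rewrite h; field.
Qed.

Lemma sum_total_lengthR (R : realType) (n : nat) : (1 <= n)%N ->
  \sum_(M in matchings n) (total_length M)%:R
    = n%:R * (2 * n%:R + 1) / 3 * #|matchings n|%:R :> R.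
Proof.
move=> n1; have m1 : ((2 * n).-1)%:R != 0 :> R by rewrite pnatr_eq0; lia.
apply: (mulIf m1); have := congr1 (GRing.natmul (1 : R)) (sum_total_length n).
rewrite -big_distrl /= !natrM natr_sum => ->.
by rewrite natr_bin3 //; field.
Qed.

(** Dividing by [(2n-1)(2n-3)] leaves the ratio [(2n-1)/(2n-3) = 1 + 2/(2n-3)] on the squared mean,
    and [n (2n)^2 = 4 n^3] from the diagonal. *)
Lemma sum_total_length_sqrR (R : realType) (n : nat) : (2 <= n)%N ->
  \sum_(M in matchings n) (total_length M)%:R ^+ 2
    <= ((n%:R * (2 * n%:R + 1) / 3) ^+ 2 * (1 + 2 / (2 * n%:R - 3)) + 4 * n%:R ^+ 3)
         * #|matchings n|%:R :> R.
Proof.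
move=> n2; have n2R : 2 <= n%:R :> R by rewrite ler_nat.
have m1E : ((2 * n).-1)%:R = 2 * n%:R - 1 :> R.
  by rewrite -subn1 natrB ?natrM //; lia.
have qE : ((2 * n.-1).-1)%:R = 2 * n%:R - 3 :> R.
  have -> : ((2 * n.-1).-1 = 2 * n - 3)%N by lia.
  by rewrite natrB ?natrM //; lia.
have C2E : 'C(2 * n, 2)%:R = n%:R * (2 * n%:R - 1) :> R.
  by rewrite bin2 -mulnA mul2n doubleK natrM m1E.
have D0 : 0 < (2 * n%:R - 1) * (2 * n%:R - 3) :> R by apply: mulr_gt0; lra.
rewrite -(ler_pM2r D0).
have := sum_total_length_sqr n; rewrite -(ler_nat R) -big_distrl /=.
rewrite !natrM natr_sum natrD !natrM natr_bin3 ?(ltnW n2) // m1E qE C2E.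
under eq_bigr do rewrite natrX.
move=> /le_trans; apply; rewrite [X in X <= _](_ : _ = (#|matchings n|%:R
  * ((n%:R * (2 * n%:R + 1) / 3 * (2 * n%:R - 1)) ^+ 2 +
   4 * n%:R ^+ 3 * (2 * n%:R - 1) * (2 * n%:R - 3)))); last by ring.
rewrite le_eqVlt; apply/orP; left; apply/eqP; field.
by apply/eqP => h; lra.
Qed.

Lemma sum_sqr_deviation (R : realType) (n : nat) : (2 <= n)%N ->
  \sum_(M in matchings n) (avg_length R M - 2 * n%:R / 3) ^+ 2
    <= 9 * n%:R * #|matchings n|%:R.
Proof.
move=> n2; have n2R : 2 <= n%:R :> R by rewrite ler_nat.
have -> : \sum_(M in matchings n) (avg_length R M - 2 * n%:R / 3) ^+ 2 =
    n%:R ^- 2 * \sum_(M in matchings n) (total_length M)%:R ^+ 2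
    - 4 / 3 * \sum_(M in matchings n) (total_length M)%:R
    + (2 * n%:R / 3) ^+ 2 * #|matchings n|%:R.
  rewrite [X in _ + X]mulr_natr -sumr_const !big_distrr /= -sumrB -big_split /=.
  apply: eq_bigr => M _; rewrite /avg_length; field.
  by apply/eqP => h; lra.
rewrite sum_total_lengthR ?(ltnW n2) //.
have n2i : 0 <= n%:R ^- 2 :> R by rewrite invr_ge0 exprn_ge0.
apply: le_trans (lerD (lerD (ler_wpM2l n2i (sum_total_length_sqrR R n2))
  (lexx _)) (lexx _)) _.
move: (card_matchings_gt0 R n) => {n2i}.
move: (#|matchings n|%:R) => a; move: n%:R n2R => x x2 a0.
(* Here [1 / 9] is the squared offset of [2n/3] from the mean [(2n+1)/3], [4 * x] comes from the
   diagonal, and the last term from the covariances. *)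
rewrite [leLHS](_ : _ = (1 / 9 + 4 * x + 2 / 9 * (2 * x + 1) ^+ 2 / (2 * x - 3)) * a).
  rewrite ler_pM2r // -lerBrDl ler_pdivrMr; last by lra.
  by nra.
field; apply/andP; split; apply/eqP => h; lra.
Qed.

(** * Chebyshev's inequality and the limit *)

(** Each [x] in [A] outside the event contributes more than [c ^+ 2] to the sum of squares. The
    upper bound [1] lets the absolute value in the limit be dropped. *)
Lemma finite_chebyshev (R : realType) (T : finType) (A : {set T}) (X : T -> R)
    (c v : R) : 0 < c -> A != finset.set0 ->
  \sum_(x in A) X x ^+ 2 <= v * #|A|%:R ->
  1 - v / c ^+ 2 <= unif_prob R A (fun x => `|X x| <= c) <= 1.
Proof.
move=> c0; rewrite -card_gt0 -(ltr0n R) => A0 hv; rewrite /unif_prob.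
set G := [set x in A | _]; apply/andP; split; last first.
  rewrite ler_pdivrMr // mul1r ler_nat subset_leq_card //.
  by apply/fintype.subsetP => x /setIdP[].
rewrite ler_pdivlMr // mulrBl mul1r lerBlDr -lerBlDl.
rewrite mulrAC ler_pdivlMr ?exprn_gt0 //; apply: le_trans hv.
have GA : G \subset A by apply/fintype.subsetP => x /setIdP[].
rewrite -natrB ?subset_leq_card // -cardsDS // mulr_natl -sumr_const.
rewrite [leRHS](big_setID G) /= -[leLHS]add0r; apply: lerD.
  by apply: sumr_ge0 => x _; apply: sqr_ge0.
apply: ler_sum => x; rewrite !inE => /andP[+ xA]; rewrite xA /= -ltNge => cX.
by rewrite -[X x ^+ 2]real_normK ?num_real // lerXn2r ?nnegrE ?normr_ge0 ?(ltW c0) ?(ltW cX).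
Qed.

Theorem corollary1p1 (R : realType) :
  (forall n : nat, (1 <= n)%N ->
     unif_expectation (matchings n) (fun M => avg_length R M)
       = (2 * n%:R + 1) / 3)
  /\
  (forall omega : nat -> R,
     omega n @[n --> \oo] --> +oo ->
     unif_prob R (matchings n)
       (fun M => `|avg_length R M - 2 * n%:R / 3| <= omega n * Num.sqrt n%:R)
       @[n --> \oo] --> (1 : R)).
Proof.
split=> [n n1|omega omegaoo].
  have n0 : n%:R != 0 :> R by rewrite pnatr_eq0 -lt0n.
  have a0 := lt0r_neq0 (card_matchings_gt0 R n).
  rewrite /unif_expectation /avg_length -big_distrl /= sum_total_lengthR //.
  by field; rewrite n0 a0.
apply/cvgrPdist_le => eps eps0; near=> n.
have n2 : (2 <= n)%N by near: n; exists 2.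
(* The failure probability is at most [9 n / (omega n ^+ 2 * n) = 9 / omega n ^+ 2]; once
   [omega n >= 1] this is at most [9 / omega n], hence at most [eps] once [omega n >= 9 / eps]. *)
have w1 : 1 <= omega n by near: n; move/cvgryPge: omegaoo; apply.
have weps : 9 / eps <= omega n by near: n; move/cvgryPge: omegaoo; apply.
have n0 : 0 < n%:R :> R by rewrite ltr0n; lia.
have c0 : 0 < omega n * Num.sqrt n%:R.
  by rewrite mulr_gt0 ?sqrtr_gt0 // (lt_le_trans ltr01).
have /andP[lo hi] := finite_chebyshev c0 (matchings_neq0 n) (sum_sqr_deviation R n2).
rewrite ger0_norm ?subr_ge0 // lerBlDr -lerBlDl; apply: le_trans lo.
rewrite lerD2l lerN2 exprMn sqr_sqrtr ?(ltW n0) // -mulf_div divff ?lt0r_neq0 // mulr1.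
rewrite ler_pdivrMr ?exprn_gt0 ?(lt_le_trans ltr01) //.
rewrite ler_pdivrMr // in weps.
nra.
Unshelve. all: by end_near. Qed.
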